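(* For any permutation matrix $A$ of order $n$, there is a permutation matrix $T$ (of order $n$), such that $$T^{-1}AT=\operatorname{diag}\{I_t,N_{k_1},\dots,N_{k_r}\},$$ where $N_{k_i}$ is the cycle matrix of order $k_i$ in standard form ($i=1,2,\dots,r$), $2\le k_1\le k_2\le\cdots\le k_r$, $0\le r\le\lfloor n/2\rfloor$, $0\le t\le n$, and $\sum_{i=1}^{r}k_i+t=n$. Moreover $T$, $t$, $r$, $k_r$ are determined by $A$.
   Context: Let $n$ be a positive integer. A permutation matrix of order $n$ is a square matrix of order $n$ with all entries in $\{0,1\}$ having a unique entry $1$ in every row and every column. $I_t$ denotes the identity matrix of order $t$ (absent if $t=0$). For an integer $k\ge 2$, the cycle matrix of order $k$ in standard form is $$N_k=\begin{bmatrix}0&&&&1\\1&0&&&\\&1&\ddots&&\\&&\ddots&\ddots&\\&&&1&0\end{bmatrix},$$ i.e. the $k\times k$ matrix whose entries in positions $(v+1,v)$ for $1\le v\le k-1$ and in position $(1,k)$ are $1$ and whose other entries are $0$. $\operatorname{diag}\{B_0,B_1,\dots,B_r\}$ denotes the block-diagonal matrix with the listed diagonal blocks; when $r=0$ there are no blocks $N_{k_i}$.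
   Formalization: T is not literally determined by A (for A = I_2 both permutation matrices of order 2 work); what is proved is that t, r and all k_i are unique and that any two admissible T, T' satisfy: T'T^{-1} commutes with A. *)

(* Defs.v *)
From mathcomp Require Import all_boot all_order all_fingroup all_algebra.

Set Implicit Arguments.
Unset Strict Implicit.
Unset Printing Implicit Defensive.

Import GRing.Theory.
Local Open Scope ring_scope.

Lemma is_perm_mx_entrywise (R : comUnitRingType) (n : nat) (A : 'M[R]_n) :
  is_perm_mx A <->
  [/\ forall i j, A i j = 0 \/ A i j = 1,
      forall i, exists! j, A i j = 1 &
      forall j, exists! i, A i j = 1].
Proof.
split.
  have nat1 (b : bool) : b%:R = 1 :> R <-> b.
    by case: b; split=> // /eqP; rewrite eq_sym oner_eq0.
  case/is_perm_mxP=> s ->; split.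
  - by move=> i j; rewrite !mxE; case: (_ == _); [right | left].
  - move=> i; exists (s i); split=> [|j]; rewrite !mxE ?eqxx //.
    by move/nat1/eqP.
  - move=> j; exists ((s^-1)%g j); split=> [|i]; rewrite !mxE ?permKV ?eqxx //.
    by move/nat1/eqP <-; rewrite permK.
case=> A01 Arow Acol.
have /fin_all_exists [f fP] i : exists j, A i j = 1 /\ forall k, A i k = 1 -> k = j.
  by have [j [Aij jP]] := Arow i; exists j; split=> // k /jP.
have f_inj : injective f.
  move=> i1 i2 eq_f; have [i [_ iP]] := Acol (f i1).
  rewrite -(iP i1) ?(proj1 (fP i1)) //; apply: iP.
  by rewrite eq_f (proj1 (fP i2)).
apply/is_perm_mxP; exists (perm f_inj); apply/matrixP=> i j.
rewrite !mxE permE; case: eqP => [<-|ne]; first by case: (fP i).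
by case: (A01 i j) => // /(proj2 (fP i)) eq_j; case: ne.
Qed.

Definition cycle_mx (R : comUnitRingType) (k : nat) : 'M[R]_k :=
  \matrix_(i, j) ((i == j.+1 :> nat)
                  || ((i == 0 :> nat) && (j.+1 == k :> nat)))%N%:R.

Definition cycle_diag_mx (R : comUnitRingType) (t r : nat) (k : r.-tuple nat) :
    'M[R]_(t + \sum_(i < r) tnth k i) :=
  block_mx 1%:M 0 0 (\mxdiag_(i < r) cycle_mx R (tnth k i)).

(* The equation E says that the orders of the blocks add up to n; castmx uses it
   to see the block-diagonal matrix as a matrix of order n. *)
Definition cycle_normal_form (R : comUnitRingType) (n : nat) (A T : 'M[R]_n)
    (t r : nat) (k : r.-tuple nat) : Prop :=
  [/\ is_perm_mx T,
      sorted leq k /\ (forall i, 2 <= tnth k i)%N,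
      (r <= n %/ 2)%N,
      (t <= n)%N &
      exists E : (t + \sum_(i < r) tnth k i)%N = n,
        invmx T *m A *m T = castmx (E, E) (cycle_diag_mx R t k)].

(* Main.v *)
(* Writing A as the matrix of a permutation s, a reduction of A to the normal
   form is the same thing as a bijection from the disjoint union of t points and
   of r cyclically ordered sets of sizes k_1, ..., k_r onto the index set of A,
   transporting the cyclic shift to s^-1. Existence is obtained by listing the
   orbits of s^-1 by increasing size. For uniqueness, the number of points whose
   orbit has size d depends only on s, and it is d times the number of k_i equal
   to d when d > 1, and t when d = 1. Two reducing matrices T and T' then give
   the same normal form, so that T' T^-1 commutes with A. *)
Require Import Defs.
From mathcomp Require Import all_boot all_order all_fingroup all_algebra.

Set Implicit Arguments.
Unset Strict Implicit.

Import GRing.Theory.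
Local Open Scope ring_scope.

(** * Orbit sizes and iterated cyclic successors *)

Lemma order_eq (X : finType) (f : X -> X) (x : X) (k : nat) :
  injective f -> (forall m, (iter m f x == x) = (k %| m)%N) ->
  fingraph.order f x = k.
Proof.
move=> f_inj fx; have k_dvd: (k %| fingraph.order f x)%N by rewrite -fx iter_order.
apply/eqP; rewrite eqn_leq (dvdn_leq _ k_dvd) ?fingraph.order_gt0 // andbT leqNgt.
(* If [k] were below the order, the point reached after [k] steps would have index [k] in the orbit;
   but it is [x], of index 0, and 0 does not divide a positive order. *)
apply/negP=> /findex_iter; have /eqP-> : iter k f x == x by rewrite fx.
rewrite findex0 => k0; move: k_dvd; rewrite -k0 dvd0n => /eqP o0.
by have := fingraph.order_gt0 f x; rewrite o0.
Qed.

Lemma val_iter_ordS n m (i : 'I_n) :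
  iter m (@ordS n) i = ((i + m) %% n)%N :> nat.
Proof.
elim: m => [|m IHm]; first by rewrite addn0 modn_small.
by rewrite iterS /= IHm -addn1 modnDml addn1 addnS.
Qed.

(** * The model: fixed points together with disjoint cycles *)

Section CycleIndex.

Variables (t r : nat) (p : 'I_r -> nat).

Definition cycle_index : finType := ('I_t + {i : 'I_r & 'I_(p i)})%type.

Definition cycle_shift (b : cycle_index) : cycle_index :=
  match b with
  | inl x => inl x
  | inr c => inr (Tagged (fun i => 'I_(p i)) (ordS (tagged c)))
  end.

Definition cycle_length (b : cycle_index) : nat :=
  if b is inr c then p (tag c) else 1.

(** Numbers the points in the order in which the blocks of [cycle_diag_mx] occupy rows and
    columns. *)
Definition index_rank (b : cycle_index) : 'I_(t + \sum_(i < r) p i) :=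
  unsplit match b with inl x => inl x | inr c => inr (tagnat.rank c) end.

Definition rank_index (i : 'I_(t + \sum_(i < r) p i)) : cycle_index :=
  match split i with inl x => inl x | inr j => inr (tagnat.sig j) end.

Lemma index_rankK : cancel index_rank rank_index.
Proof.
by case=> [x|c]; rewrite /rank_index /index_rank unsplitK //= tagnat.rankK.
Qed.

Lemma rank_indexK : cancel rank_index index_rank.
Proof.
move=> i; rewrite -[RHS]splitK /rank_index /index_rank.
by case: (split i) => [x|j] //; rewrite tagnat.sigK.
Qed.

Lemma iter_cycle_shift_eq m b :
  (iter m cycle_shift b == b) = (cycle_length b %| m)%N.
Proof.
case: b => [x|[i j]] /=; first by rewrite dvd1n; apply/eqP; elim: m => //= m ->.
have -> : iter m cycle_shift (inr (existT _ i j)) =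
          inr (Tagged (fun i => 'I_(p i)) (iter m (@ordS (p i)) j)).
  by elim: m => //= m ->.
rewrite (inj_eq inr_inj) eq_Tagged /=.
rewrite -val_eqE /= val_iter_ordS.
(* Writing the right side as [j + 0] modulo [p i] lets [j] cancel, leaving [m] congruent to 0. *)
by rewrite -[X in _ == X](modn_small (ltn_ord j)) -[X in _ == X %[mod _]]addn0 eqn_modDl mod0n.
Qed.

(** The sum splits along the disjoint union: a cycle of length [d] contributes its [d] points, and
    the fixed points contribute only for [d = 1]. *)
Lemma card_cycle_length d :
  #|[pred b | cycle_length b == d]| = (count_mem d (codom p) * d + (d == 1) * t)%N.
Proof.
rewrite -sum1_card big_mkcond /= big_sumType /= addnC; congr addn.
  rewrite -(@sig_big_dep _ _ _ _ (fun i => 'I_(p i)) xpredT (fun _ _ => true)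
    (fun i _ => if p i == d then 1 else 0)%N) /=.
  rewrite -sum1_count big_distrl /= big_image_cond /= [RHS]big_mkcond /=.
  by apply: eq_bigr => i _; case: eqP => [->|_];
    rewrite sum_nat_const card_ord ?muln1 ?mul1n ?muln0.
rewrite (eq_bigr (fun=> nat_of_bool (d == 1%N))) => [|i _]; last by rewrite inE eq_sym; case: eqP.
by rewrite sum_nat_const card_ord mulnC.
Qed.

Section Conjugation.

Variables (X : finType) (f : X -> X) (h : cycle_index -> X).
Hypotheses (f_inj : injective f) (h_bij : bijective h).
Hypothesis fh : forall b, f (h b) = h (cycle_shift b).

Lemma order_cycle_index b : fingraph.order f (h b) = cycle_length b.
Proof.
apply: order_eq => // m; rewrite -iter_cycle_shift_eq -(inj_eq (bij_inj h_bij)).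
by congr (_ == _); elim: m => //= m ->.
Qed.

Lemma card_order_cycle_index d :
  #|[pred x | fingraph.order f x == d]| =
    (count_mem d (codom p) * d + (d == 1) * t)%N.
Proof.
rewrite -card_cycle_length -!sum1_card (reindex h); last exact: onW_bij.
by apply: eq_bigl => b; rewrite !inE order_cycle_index.
Qed.

End Conjugation.

End CycleIndex.

(** * Uniqueness and existence of the cycle decomposition of an injective map *)

Lemma codom_tnth (r : nat) (X : Type) (k : r.-tuple X) : codom (tnth k) = k.
Proof. by rewrite /codom /image_mem map_tnth_enum. Qed.

Lemma cycle_index_unique (X : finType) (f : X -> X) (t t' r r' : nat)
    (k : r.-tuple nat) (k' : r'.-tuple nat)
    (h : cycle_index t (tnth k) -> X) (h' : cycle_index t' (tnth k') -> X) :
  injective f ->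
  sorted leq k -> (forall i, 2 <= tnth k i)%N -> bijective h ->
  (forall b, f (h b) = h (cycle_shift b)) ->
  sorted leq k' -> (forall i, 2 <= tnth k' i)%N -> bijective h' ->
  (forall b, f (h' b) = h' (cycle_shift b)) ->
  t' = t /\ k' = k :> seq nat.
Proof.
move=> f_inj k_sort k_ge2 h_bij fh k'_sort k'_ge2 h'_bij fh'.
have count_small q (l : q.-tuple nat) d :
    (forall i, 2 <= tnth l i)%N -> (d < 2)%N -> count_mem d l = 0%N.
  move=> l_ge2 d_lt2; apply/count_memPn; apply/tnthP=> -[i d_def].
  by move: d_lt2; rewrite d_def ltnNge l_ge2.
have eq_card d : (count_mem d k' * d + (d == 1) * t' =
                  count_mem d k * d + (d == 1) * t)%N.
  rewrite -(codom_tnth k) -(codom_tnth k').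
  by rewrite -(card_order_cycle_index f_inj h_bij) // -(card_order_cycle_index f_inj h'_bij).
split; first by have := eq_card 1; rewrite !count_small ?mul1n.
apply: (sorted_eq leq_trans anti_leq) => //.
(* Sorted lists with the same multiplicities coincide; for [d] at least 2 the factor [d] cancels in
   [eq_card]. *)
apply/allP=> d _ /=; case: (ltnP d 2) => [d_lt2|d_ge2]; first by rewrite !count_small.
have := eq_card d; rewrite gtn_eqF // !addn0 => /eqP.
by rewrite eqn_pmul2r // (ltn_trans _ d_ge2).
Qed.

(** Each nontrivial orbit is entered at its canonical root, and position [j] of the cycle is the
    [j]-th iterate of that root. *)
Lemma cycle_index_exists (X : finType) (f : X -> X) : injective f ->
  exists (t r : nat) (k : r.-tuple nat) (h : cycle_index t (tnth k) -> X),
    [/\ sorted leq k, forall i, (2 <= tnth k i)%N, bijective h &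
        forall b, f (h b) = h (cycle_shift b)].
Proof.
move=> f_inj.
pose A := [pred x | f x == x]; pose o := fingraph.order f.
have o_fix x : (o x == 1) = (f x == x).
  apply/eqP/eqP=> [ox1|fx]; first by rewrite -[RHS](iter_order f_inj) -/o ox1.
  by apply: order_eq => // m; rewrite dvd1n; apply/eqP; elim: m => //= m ->.
(* One root per orbit of size at least 2, sorted by orbit size so that the list of lengths [k] comes
   out sorted. *)
pose rs := sort (relpre o leq) [seq x <- enum X | froots f x & (1 < o x)%N].
have rsE x : (x \in rs) = froots f x && (1 < o x)%N.
  by rewrite mem_sort mem_filter mem_enum andbT.
have rs_uniq : uniq rs by rewrite sort_uniq filter_uniq ?enum_uniq.
pose z := tnth (in_tuple rs).
have z_rs i : froots f (z i) && (1 < o (z i))%N.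
  by rewrite -rsE; exact: (mem_tnth i (in_tuple rs)).
have z_inj : injective z by apply/tuple_uniqP.
pose k := map_tuple o (in_tuple rs).
have kE i : tnth k i = o (z i) by rewrite tnth_map.
pose h (b : cycle_index #|A| (tnth k)) : X :=
  match b with
  | inl x => enum_val x
  | inr c => iter (tagged c) f (z (tag c))
  end.
have o_iter m x : o (iter m f x) = o x.
  by apply: eq_card => y; rewrite !inE -(same_connect (fconnect_sym f_inj) (fconnect_iter f m x)).
exists #|A|, (size rs), k, h; split.
- by rewrite /k /= sorted_map sort_sorted // => x y; apply: leq_total.
- by move=> i; rewrite kE; case/andP: (z_rs i).
- have h_inj : injective h.
    have sep (x : 'I_#|A|) c : h (inl x) <> h (inr c).
      move=> /= hE; have /eqP := enum_valP x; rewrite hE => /eqP.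
      by rewrite -o_fix o_iter => /eqP o1; have := z_rs (tag c); rewrite o1 andbF.
    case=> [x|c] [x'|c'].
    - by move/enum_val_inj->.
    - by move/sep.
    - by move/esym/sep.
    case: c c' => [i j] [i' j'] /= hE.
    have eq_i : i = i'.
      (* Both roots are connected to the common image, so they are the same root. *)
      apply: z_inj; have [/andP[/eqP <- _] /andP[/eqP <- _]] := (z_rs i, z_rs i').
      apply/(fingraph.rootP (fconnect_sym f_inj)).
      by rewrite (same_connect (fconnect_sym f_inj) (fconnect_iter f j _)) hE
                 fconnect_sym ?fconnect_iter.
    case: i' / eq_i j' hE => j' hE; congr (inr (Tagged _ _)); apply: val_inj => /=.
    (* Below the orbit size, [findex] recovers the exponent from the iterate. *)
    by rewrite -(@findex_iter _ f (z i) j) -/o -?kE // hE findex_iter // -/o -kE.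
  have h_surj y : exists b, h b = y.
    have [fy|fy] := boolP (y \in A).
      by exists (inl (enum_rank_in fy y)); rewrite /= enum_rankK_in.
    have y_root : fconnect f (froot f y) y.
      by rewrite fconnect_sym ?connect_root.
    have z_y : froot f y \in rs.
      rewrite rsE roots_root; last exact: fconnect_sym.
      rewrite ltn_neqAle fingraph.order_gt0 andbT eq_sym.
      by rewrite -(iter_findex y_root) inE -o_fix o_iter in fy.
    have [i zi] := tnthP (in_tuple rs) _ z_y.
    have j_lt : (findex f (z i) y < tnth k i)%N.
      by rewrite kE findex_max // /z -zi.
    exists (inr (Tagged (fun i => 'I_(tnth k i)) (Ordinal j_lt))) => /=.
    by rewrite iter_findex // /z -zi.
  have [g hgK] := fin_all_exists h_surj.
  by exists g => // b; apply: h_inj.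
- case=> [x|[i j]] /=; first by apply/eqP; exact: (enum_valP x).
  (* The last case is the wrap-around: [ordS] returns to 0 just as the iteration returns to the
     root. *)
  rewrite -iterS; case: (ltngtP j.+1 (tnth k i)) => [j_lt|j_gt|jE].
  + by rewrite modn_small.
  + by move: (ltn_ord j); rewrite ltnNge -ltnS j_gt.
  + by rewrite jE modnn kE iter_order.
Qed.

(** * Translation between matrices and the model *)

Section NormalForm.

Variables (R : comUnitRingType) (n : nat).
Implicit Types (s : {perm 'I_n}).

Lemma invmx_perm s : invmx (perm_mx s) = perm_mx s^-1 :> 'M[R]_n.
Proof.
by rewrite -[RHS](mulmxK (unitmx_perm R s)) -perm_mxM mulVg perm_mx1 mul1mx.
Qed.

(** The 1 of column [j] lies in the row of the successor of [j], whereas [perm_mx s] has its 1 of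
    row [i] in column [s i]; hence the shift corresponds to the inverse of [s]. *)
Lemma cycle_diag_mxE (t r : nat) (k : r.-tuple nat) i j :
  cycle_diag_mx R t k i j = (rank_index i == cycle_shift (rank_index j))%:R.
Proof.
rewrite /cycle_diag_mx /rank_index -{1}(splitK i) -{1}(splitK j).
case: (split i) (split j) => [x|a] [y|b] /=.
- by rewrite block_mxEul mxE.
- by rewrite block_mxEur mxE.
- by rewrite block_mxEdl mxE.
rewrite block_mxEdr /mxdiag mxE /tagnat.sig2 /tagnat.sig1.
case: (tagnat.sig a) (tagnat.sig b) => [i1 a'] [i2 b'] /=.
case: eqP => [eq_i|ne_i]; last first.
  rewrite mxE; case: eqP => // -[eq_i _]; by case: ne_i.
case: i2 / eq_i b' => b'; rewrite conform_mx_id mxE; congr _%:R.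
rewrite (inj_eq inr_inj) eq_Tagged -val_eqE /=; congr nat_of_bool.
(* The top right corner entry of the cycle matrix is the wrap-around of [ordS]. *)
case: (ltngtP b'.+1 (tnth k i1)) => [b_lt|b_gt|bE].
- by rewrite modn_small // andbF orbF.
- by move: (ltn_ord b'); rewrite ltnNge -ltnS b_gt.
- by rewrite bE modnn andbT ltn_eqF.
Qed.

(** With the reducing matrix written as [perm_mx v^-1], [v] is the map from positions in the normal
    form to indices of the original matrix. *)
Lemma conj_perm_mxE s v i j :
  (invmx (perm_mx v^-1) *m perm_mx s *m perm_mx v^-1) i j =
    (s (v i) == v j)%:R :> R.
Proof.
by rewrite invmx_perm invgK -!perm_mxM !mxE !permM -[in LHS](inj_eq (@perm_inj _ v)) permKV.
Qed.

Lemma cycle_index_of_normal_form s (T : 'M[R]_n) (t r : nat) (k : r.-tuple nat) :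
  cycle_normal_form (perm_mx s) T t k ->
  exists h : cycle_index t (tnth k) -> 'I_n,
    bijective h /\ forall b, (s^-1)%g (h b) = h (cycle_shift b).
Proof.
case=> /is_perm_mxP[u ->] _ _ _ [E Eq].
exists (fun b => (u^-1)%g (cast_ord E (index_rank b))); split.
  exists (fun x => rank_index (cast_ord (esym E) (u x))) => [b|x].
    by rewrite permKV cast_ordK index_rankK.
  by rewrite rank_indexK cast_ordKV permK.
move=> b; apply: (@perm_inj _ s); rewrite permKV; apply/eqP.
rewrite eq_sym; apply: contraTT isT => ne.
(* One entry suffices: in row [cycle_shift b] and column [b] the normal form has a 1, while [ne]
   would make the conjugate 0 there. *)
have := congr1 (fun M : 'M[R]_n => M (cast_ord E (index_rank (cycle_shift b)))
                                     (cast_ord E (index_rank b))) Eq.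
rewrite -[u]invgK conj_perm_mxE (negPf ne) castmxE !cast_ordK.
rewrite cycle_diag_mxE !index_rankK eqxx => /eqP.
by rewrite eq_sym oner_eq0.
Qed.

Lemma normal_form_of_cycle_index s (t r : nat) (k : r.-tuple nat)
    (h : cycle_index t (tnth k) -> 'I_n) :
  sorted leq k -> (forall i, 2 <= tnth k i)%N -> bijective h ->
  (forall b, (s^-1)%g (h b) = h (cycle_shift b)) ->
  exists T : 'M[R]_n, cycle_normal_form (perm_mx s) T t k.
Proof.
move=> k_sort k_ge2 h_bij sh.
have E : (t + \sum_(i < r) tnth k i)%N = n.
  have rank_bij := Bijective (@rank_indexK t r (tnth k)) (@index_rankK t r (tnth k)).
  by rewrite -(card_ord n) -(bij_eq_card (bij_comp h_bij rank_bij)) card_ord.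
have v_inj : injective (fun x => h (rank_index (cast_ord (esym E) x))).
  by move=> x y /(bij_inj h_bij)/(can_inj (@rank_indexK _ _ _))/cast_ord_inj.
exists (perm_mx (perm v_inj)^-1); split.
- exact: perm_mx_is_perm.
- by [].
(* Every cycle uses at least two of the [n] indices, which bounds [r] by half of [n]. *)
- have : (\sum_(i < r) 2 <= n)%N.
    by rewrite -E; apply: leq_trans (leq_addl _ _); apply: leq_sum => i _; apply: k_ge2.
  by rewrite sum_nat_const card_ord leq_divRL.
- by rewrite -E leq_addr.
exists E; apply/matrixP=> i j; rewrite conj_perm_mxE castmxE cycle_diag_mxE !permE.
congr _%:R; rewrite -(inj_eq (bij_inj h_bij)) -sh.
by rewrite -[in RHS](inj_eq (@perm_inj _ s)) permKV.
Qed.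

End NormalForm.

(** This is the sense in which [T] is determined by [A]: any other choice is [T] multiplied on the
    left by an invertible matrix commuting with [A]. *)
Lemma cycle_normal_form_comm (R : comUnitRingType) (n : nat) (A T T' : 'M[R]_n)
    (t r : nat) (k : r.-tuple nat) :
  cycle_normal_form A T t k -> cycle_normal_form A T' t k ->
  comm_mx A (T' *m invmx T).
Proof.
have perm_unit (M : 'M[R]_n) : is_perm_mx M -> M \in unitmx.
  by case/is_perm_mxP=> u ->; exact: unitmx_perm.
case=> /perm_unit uT _ _ _ [E Eq] [/perm_unit uT' _ _ _ [E' Eq']].
(* The two casts agree because proofs of an equality of natural numbers are unique. *)
have {}Eq : invmx T' *m A *m T' = invmx T *m A *m T.
  by rewrite Eq Eq' (eq_irrelevance E E').
have := congr1 (fun M => T' *m M *m invmx T) Eq.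
by rewrite /comm_mx !mulmxA mulmxV // mul1mx mulmxK.
Qed.

Unset Implicit Arguments.
Set Strict Implicit.

Theorem theorem3 (R : comUnitRingType) (n : nat) (n_gt0 : (0 < n)%N)
    (A : 'M[R]_n) (A_perm : is_perm_mx A) :
  exists (T : 'M[R]_n) (t r : nat) (k : r.-tuple nat),
    cycle_normal_form A T t k /\
    (forall (T' : 'M[R]_n) (t' r' : nat) (k' : r'.-tuple nat),
       cycle_normal_form A T' t' k' ->
       [/\ t' = t, r' = r, k' = k :> seq nat &
           comm_mx A (T' *m invmx T)]).
Proof.
have /is_perm_mxP[s ->] := A_perm.
have f_inj : injective (s^-1)%g := perm_inj.
have [t [r [k [h [k_sort k_ge2 h_bij sh]]]]] := cycle_index_exists f_inj.
have [T nfT] := normal_form_of_cycle_index R k_sort k_ge2 h_bij sh.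
exists T, t, r, k; split=> // T' t' r' k' nfT'.
have [h' [h'_bij sh']] := cycle_index_of_normal_form nfT'.
have [_ [k'_sort k'_ge2] _ _ _] := nfT'.
have [eq_t eq_k] := cycle_index_unique f_inj k_sort k_ge2 h_bij sh
                      k'_sort k'_ge2 h'_bij sh'.
have eq_r : r' = r by rewrite -(size_tuple k') -(size_tuple k) eq_k.
(* Once the lengths are identified, [k] and [k'] have the same type and the equality of lists lifts
   to tuples. *)
split=> //; subst t' r'; have {}eq_k : k' = k by apply: val_inj.
by subst k'; exact: cycle_normal_form_comm nfT nfT'.
Qed.
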